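(* There is a randomized distributed algorithm in the LOCAL model that, given an $n$-vertex graph $G$, an estimate of its arboricity $\alpha=\alpha(G)$ up to a constant factor, and a parameter $t$ with $2<t\le O(\sqrt{n/\log n})$, produces a proper $O(t\alpha\log n)$-coloring of $G$ in time $O(\log_t n+\log^\star n)$.
   Context: In the LOCAL model each vertex of $G$ hosts a processor that initially knows only its own neighborhood (and here also $n$ and the arboricity estimate); processors operate in synchronous rounds, in each of which they may send messages of arbitrary length to their neighbors, with unbounded local computation. Time is the number of rounds. The arboricity $\alpha(G)$ is the minimum number of forests into which $E(G)$ can be partitioned. *)

(* Defs.v *)
From mathcomp Require Import all_boot all_order all_algebra.
From mathcomp Require Import boolp reals exp.

Set Implicit Arguments.
Unset Strict Implicit.
Unset Printing Implicit Defensive.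

Import Order.TTheory GRing.Theory Num.Theory.

(* Rounding up after every logarithm does not change the number of iterations
   needed to reach a value <= 1, because the thresholds 1, 2, 4, 16, 65536, ...
   are integers. *)
Lemma logstar_exists (n : nat) : exists k, iter k (up_log 2) n <= 1.
Proof.
elim/ltn_ind: n => n IH; case: (leqP n 1) => [n1|n1]; first by exists 0.
have [|k hk] := IH (up_log 2 n); last by exists k.+1; rewrite iterSr.
case: n n1 {IH} => [|n] // n1.
by rewrite ltnS; apply: up_log_min => //; apply: ltn_expl.
Qed.

Definition logstar (n : nat) : nat := ex_minn (logstar_exists n).

Section Graphs.
Variables (V : finType) (e : rel V).

(* For a symmetric irreflexive relation, the repetition-free cycles with at
   most two vertices are the empty one and single edges walked back and
   forth. *)
Definition acyclic (r : rel V) : Prop :=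
  forall s : seq V, ucycle r s -> size s <= 2.

(* The edge {x, y} is put into the class h {x, y}. *)
Definition forest_partition (k : nat) (h : {set V} -> nat) : Prop :=
  (forall x y, e x y -> h [set x; y] < k) /\
  (forall i, i < k -> acyclic [rel x y | e x y && (h [set x; y] == i)]).

Definition forest_partitionable (k : nat) : bool :=
  `[< exists h, forest_partition k h >].

Lemma forest_partitionable_exists : exists k, forest_partitionable k.
Proof.
exists #|{set V}|; apply/asboolP.
exists (fun A => nat_of_ord (enum_rank A)); split=> [x y _|i _]; first exact: ltn_ord.
case=> [|x [|y [|z s]]] // /andP[] /=.
case/andP=> /andP[_ /eqP h1] /andP[/andP[_ /eqP h2] _].
have /setP/(_ x) : [set x; y] = [set y; z].
  by apply: enum_rank_inj; apply: ord_inj; rewrite h1 h2.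
rewrite !inE eqxx /= => /esym xyz.
by rewrite orbA xyz.
Qed.

Definition arboricity : nat := ex_minn forest_partitionable_exists.

Definition proper_coloring (q : nat) (f : V -> nat) : bool :=
  [forall v, f v < q] && [forall u, forall v, e u v ==> (f u != f v)].

End Graphs.

(* Randomized algorithms in the LOCAL model, for processors that all know a
   global parameter p : P.  A processor starts from its own identifier, the
   list of identifiers of its neighbours and its private coin tosses; in each
   round it sends one message to each neighbour (addressed by identifier) and
   updates its state from the list of (sender, message) pairs it receives.
   States and messages are arbitrary, and so are the local functions. *)
Record local_algorithm (P : Type) := LocalAlgorithm {
  state : Type;
  message : Type;
  coins : P -> nat;
  rounds : P -> nat;
  init : forall p : P, nat -> seq nat -> (coins p).-tuple bool -> state;
  send : state -> nat -> message;
  receive : state -> seq (nat * message) -> state;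
  output : state -> nat
}.

Section Execution.
Variables (P : Type) (A : local_algorithm P) (p : P).
Variables (V : finType) (e : rel V) (id : V -> nat).

(* Listed by increasing identifier, so that the order carries no
   information. *)
Definition neighbours (v : V) : seq V :=
  sort (relpre id leq) (enum [pred u | e v u]).

Definition coin_tosses := {ffun V -> (coins A p).-tuple bool}.

Fixpoint state_after (w : coin_tosses) (k : nat) (v : V) : state A :=
  match k with
  | 0 => init (id v) [seq id u | u <- neighbours v] (w v)
  | j.+1 => receive (state_after w j v)
              [seq (id u, send (state_after w j u) (id v)) | u <- neighbours v]
  end.

Definition run (w : coin_tosses) (v : V) : nat :=
  output (state_after w (rounds A p) v).

End Execution.

Definition uniform_prob (R : realType) (T : finType) (E : pred T) : R :=
  (#|E|%:R / #|T|%:R)%R.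

(* Main.v *)
(* For O(log_t n) rounds, every vertex whose degree among the remaining vertices
   is at most D = O(t alpha) removes itself.  Since an s-vertex subgraph has at
   most alpha s edges, each round divides the number of remaining vertices by t,
   so nobody is left at the end; and if every edge is oriented away from the
   endpoint removed first (both ways on a tie), all out-degrees are at most D.

   The coin tosses of a vertex form L = O(log n) blocks of m bits, with
   2 D <= 2^m = O(D).  A vertex picks the first index j for which its j-th block
   differs from the j-th blocks of all its out-neighbours, and takes the pair
   (j, j-th block) as its colour: equal colours at the ends of an edge would
   contradict the choice made at its tail.  All L indices fail at a given vertex
   with probability at most (D / 2^m)^L <= 2^-L <= n^-(c+1), and a union bound
   over the vertices concludes. *)
Require Import Defs.
From mathcomp Require Import all_boot all_order all_algebra.
From mathcomp Require Import boolp reals exp zify ring.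

Set Implicit Arguments.
Unset Strict Implicit.
Unset Printing Implicit Defensive.

Lemma leq_exp2 a b i : a <= b -> a ^ i <= b ^ i.
Proof. by case: i => // i; rewrite leq_exp2r. Qed.

(** * Edge density of graphs of bounded arboricity *)

Section ForestDensity.
Variable V : finType.
Implicit Types (r : rel V) (S : {set V}).

Definition nbrs_in r S v := [set u in S | r v u].

(** Take a longest simple path inside [S]. By maximality all neighbours in [S] of its first vertex
    lie on the path, and any of them other than the second vertex would close a cycle on at least
    three vertices. *)
Lemma acyclic_leaf r S :
  symmetric r -> irreflexive r -> acyclic r -> S != set0 ->
  exists2 x, x \in S & #|nbrs_in r S x| <= 1.
Proof.
move=> symr irrr acyr /set0Pn[x0 x0S].
pose good n := `[< exists x p,
  [/\ size p = n, path r x p, uniq (x :: p) & all [in S] (x :: p)] >].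
have ex_good : exists n, good n.
  by exists 0; apply/asboolP; exists x0, [::]; split=> //=; rewrite x0S.
have good_ub n : good n -> n <= #|V|.
  move/asboolP=> [x [p [<- _ /card_uniqP szp _]]].
  by apply: leq_trans (max_card [in x :: p]); rewrite szp.
case: (ex_maxnP ex_good good_ub) => n /asboolP[x [p [szp pathp uniqp /andP[xS pS]]]] maxn.
exists x => //; rewrite leqNgt; apply/negP => /card_gt1P[y [z [yN zN yz]]].
have in_p u : u \in nbrs_in r S x -> u \in p.
  rewrite inE => /andP[uS xu]; apply/negPn/negP => up.
  have /maxn : good n.+1; last by rewrite ltnn.
  apply/asboolP; exists u, (x :: p); split; rewrite /= ?szp //.
  - by rewrite symr xu.
  - move: uniqp => /= ->; rewrite andbT inE negb_or up andbT.
    by apply: contraTneq xu => ->; rewrite irrr.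
  - by rewrite uS xS.
have cyc u q1 q2 : u \in nbrs_in r S x -> p = q1 ++ u :: q2 -> q1 = [::].
  rewrite inE => /andP[_ xu] pE; apply/nilP.
  have : size (x :: rcons q1 u) <= 2.
    apply: acyr; rewrite /ucycle /=; move: pathp uniqp; rewrite pE -cat_rcons.
    rewrite cat_path -cat_cons cat_uniq => /andP[pq _] /andP[uq _].
    by rewrite rcons_path pq last_rcons symr xu /=.
  by rewrite /= size_rcons /nilp; case: (size q1).
have head_p u : u \in nbrs_in r S x -> exists q, p = u :: q.
  move=> uN; have [q1 [q2 pE]] : exists q1 q2, p = q1 ++ u :: q2.
    by case/splitPr: (in_p u uN) => q1 q2; exists q1, q2.
  by exists q2; rewrite {1}pE (cyc u q1 q2 uN pE).
have [q1 p1] := head_p y yN; have [q2 p2] := head_p z zN.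
by move: p2 yz; rewrite p1 => -[->]; rewrite eqxx.
Qed.

Lemma card_nbrs_in r S v : #|nbrs_in r S v| = \sum_(u in S) r v u.
Proof.
rewrite -sum1_card (eq_bigl (fun u => (u \in S) && r v u)) => [|u]; last by rewrite inE.
by rewrite big_mkcondr; apply: eq_bigr => u _; case: (r v u).
Qed.

(** Induction on [S]: deleting a leaf loses at most one arc out of it and one arc into it. *)
Lemma acyclic_arcs r S :
  symmetric r -> irreflexive r -> acyclic r ->
  \sum_(v in S) #|nbrs_in r S v| <= 2 * #|S|.
Proof.
move=> symr irrr acyr; elim/ltn_ind: {S}#|S| {-2}S (erefl #|S|) => n IH S szS.
have [->|S_n0] := eqVneq S set0; first by rewrite big_set0.
have [x xS lex1] := acyclic_leaf symr irrr acyr S_n0.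
have cardSx : #|S| = #|S :\ x|.+1 by rewrite (cardsD1 x S) xS.
have /(_ _ _ (erefl _)) := IH #|S :\ x|; rewrite -szS cardSx ltnSn => /(_ isT) IHx.
rewrite (big_setD1 x) //=.
rewrite (eq_bigr (fun v => r v x + #|nbrs_in r (S :\ x) v|)); last first.
  by move=> v _; rewrite !card_nbrs_in (big_setD1 x).
rewrite big_split /= (eq_bigr (fun v => r x v : nat)); last by move=> v _; rewrite symr.
suff : \sum_(v in S :\ x) r x v <= 1 by lia.
by apply: leq_trans lex1; rewrite card_nbrs_in [leqRHS](big_setD1 x) //= leq_addl.
Qed.

Lemma arboricity_arcs (e : rel V) S :
  symmetric e -> irreflexive e ->
  \sum_(v in S) #|nbrs_in e S v| <= 2 * arboricity e * #|S|.
Proof.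
move=> syme irre; rewrite /arboricity; case: ex_minnP => k /asboolP[h [hk acyh]] _.
pose r (i : nat) := [rel x y | e x y && (h [set x; y] == i)].
have -> : 2 * k * #|S| = \sum_(i < k) 2 * #|S|.
  by rewrite sum_nat_const card_ord; lia.
have arcs_le (i : 'I_k) : true -> \sum_(v in S) #|nbrs_in (r i) S v| <= 2 * #|S|.
  move=> _; apply: acyclic_arcs (acyh i (ltn_ord i)).
  - by move=> x y /=; rewrite syme setUC.
  - by move=> x /=; rewrite irre.
apply: leq_trans (leq_sum _ arcs_le).
rewrite exchange_big; apply: leq_sum => v _.
under eq_bigr do rewrite card_nbrs_in.
rewrite card_nbrs_in exchange_big; apply: leq_sum => u _ /=.
(* Every edge belongs to the forest named by [h], so the sum over the forests counts it. *)
have [evu|//] := boolP (e v u).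
by rewrite (bigD1 (Ordinal (hk _ _ evu))) //= eqxx.
Qed.

End ForestDensity.

(** * Peeling off low-degree vertices and the orientation it induces *)

Section Peeling.
Variables (V : finType) (e : rel V) (D : nat).

Definition peel (S : {set V}) : {set V} := [set v in S | D < #|nbrs_in e S v|].

Definition alive k : {set V} := iter k peel setT.

Lemma alive_sub i j : i <= j -> alive j \subset alive i.
Proof.
move/subnK <-; elim: (j - i) => //= k; apply: subset_trans.
by apply/subsetP => v; rewrite inE => /andP[].
Qed.

Lemma card_peel S : symmetric e -> irreflexive e ->
  #|peel S| * D.+1 <= 2 * arboricity e * #|S|.
Proof.
move=> syme irre; apply: leq_trans (arboricity_arcs S syme irre).
rewrite -sum_nat_const [leqRHS](big_setID (peel S)) /=.
have /setIidPr -> : peel S \subset S by apply/subsetP => v; rewrite inE => /andP[].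
apply: leq_trans (leq_addr _ _); apply: leq_sum => v.
by rewrite inE => /andP[].
Qed.

(* The orientation of the edges: [u] is peeled no earlier than [v]; an edge
   inside one layer points both ways. *)
Definition out r (v : V) : {set V} :=
  [set u | e v u && [forall i : 'I_r, (v \in alive i) ==> (u \in alive i)]].

(** The sets [alive i] decrease, so if one of them contains [v] but not [u], each one that contains
    [u] also contains [v]. *)
Lemma out_total r u v : symmetric e -> e u v -> (u \in out r v) || (v \in out r u).
Proof.
move=> syme euv; rewrite !inE euv syme euv /=.
rewrite -implyNb negb_forall; apply/implyP => /existsP[i].
rewrite negb_imply => /andP[vi ui]; apply/forallP => j; apply/implyP => uj.
case/orP: (leq_total i j) => ij; last exact: (subsetP (alive_sub ij)).
by rewrite (subsetP (alive_sub ij)) in ui.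
Qed.

(** Earlier sets contain [alive i] and later ones miss [v], so only the condition at [i] matters. *)
Lemma out_alive r i v : i < r -> v \in alive i -> v \notin alive i.+1 ->
  out r v = nbrs_in e (alive i) v.
Proof.
move=> ir vi vNi; apply/setP => u; rewrite !inE andbC; congr andb.
apply/forallP/idP => [/(_ (Ordinal ir))/implyP/(_ vi) //|ui j]; apply/implyP => vj.
case: (ltnP i j) => ij; last exact: (subsetP (alive_sub ij)).
by rewrite (subsetP (alive_sub ij)) in vNi.
Qed.

Lemma out_stable r v : v \notin alive r -> out r.+1 v = out r v.
Proof.
move=> vNr; apply/setP => u; rewrite !inE; congr andb.
apply/forallP/forallP => [H i|H i]; first exact: (H (widen_ord (leqnSn r) i)).
have [ir|ri] := ltnP i r; first exact: (H (Ordinal ir)).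
by apply/implyP => vi; rewrite (subsetP (alive_sub ri)) in vNr.
Qed.

Lemma card_out r v : v \notin alive r -> #|out r v| <= D.
Proof.
move=> vNr; have [] : exists2 i, i < r & (v \in alive i) && (v \notin alive i.+1).
  elim: r vNr => [|r IH] vNr; first by rewrite inE in vNr.
  have [vr|/IH[i ir iP]] := boolP (v \in alive r); first by exists r; rewrite ?vr.
  by exists i => //; apply: ltnW.
move=> i ir /andP[vi vNi]; rewrite (out_alive ir vi vNi).
by move: vNi; rewrite inE vi /= -leqNgt.
Qed.

End Peeling.

(** A bad [w] is encoded by a choice of one colliding member of [N] per index, together with the
    values of [w] off [v]. As [v] is not in [N], these values give back every block of [w v], hence
    [w v] itself. *)
Lemma card_all_blocks_collide (V T : finType) (B : eqType) (L : nat)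
    (block : T -> 'I_L -> B) (v : V) (N : {set V}) :
  (forall x y, block x =1 block y -> x = y) -> v \notin N ->
  #|[set w : {ffun V -> T} |
      [forall j, exists u in N, block (w v) j == block (w u) j]]|
    <= #|N| ^ L * #|T| ^ #|V|.-1.
Proof.
move=> block_inj vN; set bad := [set _ | _].
have [->|[w0 _]] := set_0Vmem bad; first by rewrite cards0.
pose x0 := w0 v.
(* The default [v] is never reached for [w] in [bad]. *)
pose witness (w : {ffun V -> T}) : {ffun 'I_L -> V} :=
  [ffun j => odflt v [pick u in N | block (w v) j == block (w u) j]].
(* Writing the fixed value [x0] at [v] leaves [#|V|.-1] free values, counted by [pffun_on x0]. *)
pose mask (w : {ffun V -> T}) : {ffun V -> T} := [ffun u => if u == v then x0 else w u].
have witnessP w j : w \in bad ->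
    witness w j \in N /\ block (w v) j = block (w (witness w j)) j.
  rewrite inE => /forallP/(_ j)/existsP[u /andP[uN wu]]; rewrite ffunE.
  by case: pickP => [u' /andP[u'N /eqP]|/(_ u)] //=; rewrite uN wu.
have inj : {in bad &, injective (fun w => (witness w, mask w))}.
  move=> w1 w2 bad1 bad2 [/ffunP eqwit /ffunP eqmask].
  have eq_off u : u != v -> w1 u = w2 u.
    by move=> uv; have := eqmask u; rewrite !ffunE (negPf uv).
  apply/ffunP => u; have [->|/eq_off //] := eqVneq u v.
  apply: block_inj => j; have [N1 ->] := witnessP w1 j bad1; have [_ ->] := witnessP w2 j bad2.
  by rewrite -eqwit eq_off //; apply: contraNneq vN => <-.
rewrite -(card_in_imset inj).
have -> : #|N| ^ L * #|T| ^ #|V|.-1 =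
    #|setX [set f : {ffun 'I_L -> V} in ffun_on [in N]]
           [set f in pffun_on x0 (predC1 v) [in T]]|.
  rewrite cardsX !cardsE card_ffun_on card_pffun_on card_ord.
  by congr (_ * _ ^ _); rewrite cardC1.
apply: subset_leq_card; apply/subsetP => _ /imsetP[w badw ->]; rewrite !inE /=.
apply/andP; split; first by apply/ffun_onP => j; case: (witnessP w j badw).
apply/pffun_onP; split=> //; apply/subsetP => u; rewrite !inE ffunE.
by apply: contraNneq => ->; rewrite eqxx.
Qed.

(** * Cutting coin tosses into blocks and reading blocks as numbers *)

Section Blocks.

(** Binary value, least significant bit first. *)
Definition bits_value : seq bool -> nat := foldr (fun (b : bool) n => b + n.*2) 0.

Lemma bits_value_lt s : bits_value s < 2 ^ size s.
Proof. by elim: s => //= b s IH; rewrite expnS; case: b; lia. Qed.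

Lemma bits_value_inj s1 s2 :
  size s1 = size s2 -> bits_value s1 = bits_value s2 -> s1 = s2.
Proof.
elim: s1 s2 => [|b1 s1 IH] [|b2 s2] //= [sz] eqv.
have [-> /(IH _ sz) ->] // : b1 = b2 /\ bits_value s1 = bits_value s2.
by move: eqv; case: b1; case: b2 => eqv; split=> //; lia.
Qed.

Variables L m : nat.

Definition block (s : seq bool) (j : nat) : seq bool := nth [::] (reshape (nseq L m) s) j.

Lemma size_block s j : size s = L * m -> j < L -> size (block s j) = m.
Proof.
move=> szs jL; have := @reshapeKl _ (nseq L m) s.
rewrite sumn_nseq szs mulnC leqnn => /(_ isT)/(congr1 (nth 0 ^~ j)).
by rewrite (nth_map [::]) ?size_reshape ?size_nseq // nth_nseq jL.
Qed.

Lemma block_inj (s1 s2 : (L * m).-tuple bool) :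
  (forall j : 'I_L, block s1 j = block s2 j) -> s1 = s2.
Proof.
move=> eqb; apply: val_inj => /=.
have sz (s : (L * m).-tuple bool) : size s <= sumn (nseq L m).
  by rewrite sumn_nseq size_tuple mulnC.
rewrite -(reshapeKr (sz s1)) -(reshapeKr (sz s2)); congr flatten.
apply: (@eq_from_nth _ [::]) => [|j]; rewrite !size_reshape // size_nseq => jL.
exact: (eqb (Ordinal jL)).
Qed.

End Blocks.

(** * The local algorithm *)

Record peel_state := PeelState {
  threshold : nat;
  nblocks : nat;
  width : nat;
  tosses : seq bool;
  (* [None] until the vertex is peeled, then the coin tosses of the neighbours
     that were still present at that moment. *)
  later : option (seq (seq bool))
}.

(** The Boolean in a message says whether its sender is still present; the sequence holds all tosses
    of the sender. *)
Definition peel_receive (s : peel_state) (msgs : seq (nat * (bool * seq bool))) :=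
  let alive_tosses := [seq x.2.2 | x <- msgs & x.2.1] in
  if ~~ later s && (size alive_tosses <= threshold s) then
    PeelState (threshold s) (nblocks s) (width s) (tosses s) (Some alive_tosses)
  else s.

Definition good_block L m (c : seq bool) (cs : seq (seq bool)) (j : nat) :=
  all (fun c' => block L m c j != block L m c' j) cs.

(** The pair of index and block is written in base [2 ^ width s]. If every index fails, [find]
    returns [nblocks s] and the colour falls outside the palette. *)
Definition peel_color (s : peel_state) : nat :=
  let j := find (good_block (nblocks s) (width s) (tosses s) (odflt [::] (later s)))
             (iota 0 (nblocks s)) in
  j * 2 ^ width s + bits_value (block (nblocks s) (width s) (tosses s) j).

Definition peel_algorithm (P : Type) (D L m r : P -> nat) : local_algorithm P :=
  @LocalAlgorithm P peel_state (bool * seq bool) (fun p => L p * m p) r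
    (fun p _ _ w => PeelState (D p) (L p) (m p) w None)
    (fun s _ => (~~ later s, tosses s)) peel_receive peel_color.

(** * Correctness of the algorithm and its failure probability *)

Section Correctness.
Variables (P : Type) (D L m r : P -> nat) (p : P).
Variables (V : finType) (e : rel V) (id : V -> nat).
Hypotheses (sym_e : symmetric e) (irr_e : irreflexive e).
Let A := peel_algorithm D L m r.
Implicit Types (w : coin_tosses A p V) (v : V).

Let alive := alive e (D p).
Let out := out e (D p).

Lemma neighboursE v u : (u \in neighbours e id v) = e v u.
Proof. by rewrite mem_sort mem_enum. Qed.

(** Induction on the rounds: the flags received mark exactly the neighbours in [alive k], so the
    local test is that of [peel]. A vertex removed in this round stores its out-neighbours by
    [out_alive], and [out_stable] keeps the stored list correct afterwards. *)
Lemma state_afterE w k v :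
  state_after e id w k v = PeelState (D p) (L p) (m p) (w v)
    (if v \in alive k then None
     else Some [seq tval (w u) | u <- neighbours e id v & u \in out k v]).
Proof.
elim: k v => [|k IH] v; first by rewrite /= inE.
rewrite [LHS]/= IH /peel_receive /=.
have [vk|vNk] := boolP (v \in alive k); last first.
  rewrite /= ifN; last by apply: contra vNk; apply: (subsetP (alive_sub _ _ (leqnSn k))).
  by rewrite /out out_stable.
rewrite /= !filter_map -!map_comp.
have -> : [seq u <- neighbours e id v |
    preim (fun u => (id u, send (state_after e id w k u) (id v))) (fun x => x.2.1) u]
    = [seq u <- neighbours e id v | u \in alive k].
  by apply: eq_filter => u /=; rewrite IH /=; case: ifP.
rewrite size_map.
have -> : size [seq u <- neighbours e id v | u \in alive k] = #|nbrs_in e (alive k) v|.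
  rewrite size_filter (permP (permEl (perm_sort _ _))) -size_filter /enum_mem -filter_predI.
  rewrite cardE /enum_mem; congr size; apply: eq_filter => u /=.
  by rewrite !inE.
have -> : (v \in alive k.+1) = (D p < #|nbrs_in e (alive k) v|).
  by rewrite /alive /= inE -/(alive k) vk.
rewrite ltnNge; case: leqP => //= le_D; do 2 congr (_ _).
have -> : out k.+1 v = nbrs_in e (alive k) v.
  by apply: out_alive; rewrite // inE -/(alive k) vk /= -leqNgt.
rewrite (@eq_in_filter _ _ (fun u => u \in nbrs_in e (alive k) v)); last first.
  by move=> u; rewrite neighboursE inE => ->; rewrite andbT.
by apply: eq_map => u /=; rewrite IH.
Qed.

Definition collide v : {set coin_tosses A p V} :=
  [set w : coin_tosses A p V | [forall j : 'I_(L p), exists u in out (r p) v,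
     block (L p) (m p) (w v) j == block (L p) (m p) (w u) j]].

Lemma run_proper w : alive (r p) = set0 -> (forall v, w \notin collide v) ->
  proper_coloring e (L p * 2 ^ m p) (run e id w).
Proof.
move=> alive0 good.
have colorP v : exists j, [/\ j < L p,
    run e id w v = j * 2 ^ m p + bits_value (block (L p) (m p) (w v) j),
    size (block (L p) (m p) (w v) j) = m p &
    forall u, u \in out (r p) v -> block (L p) (m p) (w v) j != block (L p) (m p) (w u) j].
  rewrite /run state_afterE alive0 inE /= /peel_color /=.
  set g := good_block _ _ _ _.
  have has_g : has g (iota 0 (L p)).
    move: (good v); rewrite inE negb_forall => /existsP[j].
    rewrite negb_exists => /forallP good_j.
    apply/hasP; exists (j : nat); first by rewrite mem_iota add0n ltn_ord.
    apply/allP => x /mapP[u]; rewrite mem_filter => /andP[uo _] ->.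
    by have := good_j u; rewrite uo.
  have lt_find : find g (iota 0 (L p)) < L p by rewrite has_find size_iota in has_g.
  exists (find g (iota 0 (L p))); split=> //.
    by apply: size_block; rewrite ?size_tuple.
  move=> u uo; have := nth_find 0 has_g; rewrite nth_iota // add0n => /allP; apply.
  apply/mapP; exists u => //; rewrite mem_filter uo neighboursE.
  by move: uo; rewrite inE => /andP[].
have val_lt v j : size (block (L p) (m p) (w v) j) = m p ->
    bits_value (block (L p) (m p) (w v) j) < 2 ^ m p.
  by move=> sz; rewrite -[X in 2 ^ X]sz bits_value_lt.
apply/andP; split.
  apply/forallP => v; have [j [jL -> /val_lt lt_v _]] := colorP v.
  apply: (@leq_trans (j.+1 * 2 ^ m p)); first by rewrite mulSnr ltn_add2l.
  by rewrite leq_mul2r jL orbT.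
apply/forallP => u; apply/forallP => v; apply/implyP => euv; apply/negP => /eqP.
have [i [_ -> szu sep_u]] := colorP u; have [j [_ -> szv sep_v]] := colorP v.
move=> eq_color.
(* A block value is below [2 ^ m p], so division by [2 ^ m p] recovers the index. *)
have eij : i = j.
  have := congr1 (divn^~ (2 ^ m p)) eq_color.
  by rewrite !divnMDl ?expn_gt0 // !divn_small ?val_lt // !addn0.
move: eq_color szu sep_u; rewrite {}eij => /addnI eqv szu sep_u.
have eqb := bits_value_inj (etrans szu (esym szv)) eqv.
have /orP[/sep_v|/sep_u] := out_total (D p) (r p) sym_e euv; by rewrite eqb eqxx.
Qed.

Lemma card_coin_tosses : #|coin_tosses A p V| = (2 ^ (L p * m p)) ^ #|V|.
Proof. by rewrite card_ffun card_tuple card_bool. Qed.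

(** The union bound over the vertices, with denominators cleared so that it is a count of coin
    tosses. *)
Lemma card_improper c : alive (r p) = set0 -> 0 < #|V| ->
  2 * D p <= 2 ^ m p -> #|V| ^ c.+1 <= 2 ^ L p ->
  #|[set w : coin_tosses A p V | ~~ proper_coloring e (L p * 2 ^ m p) (run e id w)]| * #|V| ^ c
    <= #|coin_tosses A p V|.
Proof.
move=> alive0 V_gt0 leDm leVL.
set N := (2 ^ (L p * m p)) ^ #|V|.-1.
have le_collide v : #|collide v| <= D p ^ L p * N.
  have -> : N = #|{: (L p * m p).-tuple bool}| ^ #|V|.-1 by rewrite card_tuple card_bool.
  apply: leq_trans (card_all_blocks_collide
    (block := fun (x : (L p * m p).-tuple bool) j => block (L p) (m p) x j) _ _) _.
  - exact: block_inj.
  - by rewrite inE irr_e.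
  - by apply: leq_mul => //; apply: leq_exp2; apply: card_out; rewrite -/(alive _) alive0 inE.
have sub_bad : [set w : coin_tosses A p V | ~~ proper_coloring e (L p * 2 ^ m p) (run e id w)]
    \subset \bigcup_v collide v.
  apply/subsetP => w; rewrite inE; apply: contraR => /bigcupP nbad.
  by apply: run_proper => // v; apply/negP => wv; apply: nbad; exists v.
have card_bad : #|\bigcup_v collide v| <= #|V| * (D p ^ L p * N).
  rewrite -sum_nat_const; elim/big_ind2: _ => [|n1 A1 n2 A2 le1 le2|v _] //.
    by rewrite cards0.
  exact: leq_trans (leq_of_leqif (leq_card_setU A1 A2)) (leq_add le1 le2).
apply: (@leq_trans (#|V| * (D p ^ L p * N) * #|V| ^ c)).
  by rewrite leq_mul2r (leq_trans (subset_leq_card sub_bad)) ?orbT.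
rewrite card_coin_tosses -(prednK V_gt0) [in leqRHS]expnS (prednK V_gt0) -/N.
have -> : #|V| * (D p ^ L p * N) * #|V| ^ c = #|V| ^ c.+1 * D p ^ L p * N.
  by rewrite expnS; lia.
rewrite leq_mul2r; apply/orP; right.
(* The factor [2 ^ L p] pays for the union bound and for [#|V| ^ c]; it is then absorbed through
   [(2 * D p) ^ L p <= (2 ^ m p) ^ L p]. *)
apply: (@leq_trans (2 ^ L p * D p ^ L p)); first by rewrite leq_mul2r leVL orbT.
by rewrite -expnMn [L p * _]mulnC expnM; apply: leq_exp2.
Qed.

End Correctness.

Import Order.TTheory GRing.Theory Num.Theory.
Local Open Scope ring_scope.

(** * Real estimates: decay of the peeling, logarithms and the final constants *)

Section Rates.
Variable R : realType.

Lemma card_alive (V : finType) (e : rel V) (D : nat) (t : R) k :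
  symmetric e -> irreflexive e -> 0 <= t ->
  2 * t * (arboricity e)%:R <= D.+1%:R ->
  #|alive e D k|%:R * t ^+ k <= #|V|%:R.
Proof.
move=> syme irre t0 leD; elim: k => [|k IH]; first by rewrite expr0 mulr1 /alive cardsT.
apply: le_trans IH; rewrite exprS mulrA ler_wpM2r ?exprn_ge0 //.
have := card_peel D (alive e D k) syme irre; rewrite -[peel _ _ _]/(alive e D k.+1).
(* The main argument cancels the arboricity; when it is 0, [card_peel] shows that nobody survives a
   round. *)
have [->|arb_gt0] := posnP (arboricity e).
  by rewrite muln0 mul0n leqn0 muln_eq0 orbF => /eqP->; rewrite mul0r.
rewrite -(ler_nat R) !natrM => le_peel.
have arb0 : 0 < 2 * (arboricity e)%:R :> R by rewrite mulr_gt0 ?ltr0n.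
rewrite -(ler_pM2l arb0); apply: le_trans le_peel.
by rewrite mulrCA mulrA -mulrA ler_wpM2l //; move: leD; rewrite mulrAC.
Qed.

(** Rounding up costs at most 1, which is at most the binary logarithm of [n]; hence the factor
    2. *)
Lemma up_log2_le_ln (n : nat) : (2 <= n)%N ->
  (up_log 2 n)%:R <= 2 / ln 2 * ln n%:R :> R.
Proof.
move=> n2; have ln2 : 0 < ln 2 :> R by rewrite ln_gt0 ?ltr1n.
have le2 : ln 2 <= ln n%:R :> R by rewrite ler_ln ?posrE ?ltr0n ?ler_nat //; lia.
rewrite mulrAC ler_pdivlMr // [leLHS]mulr_natl [leRHS]mulr_natl [leRHS]mulr2n.
have /andP[lt_n _] := up_log_bounds (isT : (1 < 2)%N) n2.
have : ln ((2 : R) ^+ (up_log 2 n).-1) <= ln n%:R.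
  by rewrite ler_ln ?posrE ?exprn_gt0 ?ltr0n ?(ltnW n2) // -natrX ler_nat ltnW.
rewrite lnXn // => le_pred.
have up0 : (0 < up_log 2 n)%N by rewrite up_log_gt0.
by rewrite -(prednK up0) mulrSr lerD.
Qed.

Lemma ltr_expr_trunc_ln (n : nat) (t : R) : (2 <= n)%N -> 1 < t ->
  n%:R < t ^+ (Num.truncn (ln n%:R / ln t)).+1.
Proof.
move=> n2 t1; have t0 : 0 < t := lt_trans ltr01 t1.
rewrite -ltr_ln ?posrE ?exprn_gt0 ?ltr0n ?(ltnW n2) // lnXn // -[ltRHS]mulr_natl.
by rewrite -ltr_pdivrMr ?ln_gt0 // truncnS_gt.
Qed.

Lemma logstar_gt0 (n : nat) : (2 <= n)%N -> (0 < logstar n)%N.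
Proof. by rewrite /logstar; case: ex_minnP => -[|k] //=; lia. Qed.

End Rates.

Theorem theorem4p6 (R : realType) (kappa K : R) (c k : nat) :
  1 <= kappa -> 0 < K ->
  exists (A : local_algorithm (nat * R * R)) (C : R),
    forall (n : nat) (a t : R) (V : finType) (e : rel V) (id : V -> nat),
      #|V| = n -> (2 <= n)%N ->
      symmetric e -> irreflexive e ->
      injective id -> (forall v, (id v < n ^ k)%N) ->
      (arboricity e)%:R <= kappa * a -> a <= kappa * (arboricity e)%:R ->
      2 < t -> t <= K * Num.sqrt (n%:R / ln n%:R) ->
      let p := (n, a, t) in
      (rounds A p)%:R <= C * (ln n%:R / ln t + (logstar n)%:R) /\
      exists q : nat,
        q%:R <= C * (t * (maxn 1 (arboricity e))%:R * ln n%:R) /\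
        1 - (n%:R ^+ c)^-1 <=
          uniform_prob R
            [pred w : coin_tosses A p V | proper_coloring e q (run e id w)].
Proof.
move=> kappa1 _.
(* [kappa * a] is an upper bound on the arboricity computable from the parameters, so [(D p).+1]
   exceeds [2 * t] times the arboricity. *)
pose D (p : nat * R * R) := Num.truncn (2 * p.2 * (kappa * p.1.2)).
(* Chosen so that [n ^ c.+1 <= 2 ^ L p]. *)
pose L (p : nat * R * R) := (c.+1 * up_log 2 p.1.1)%N.
(* The [maxn 1] makes [m p] positive even if [D p] is 0, which yields
   [2 ^ m p <= 4 * maxn 1 (D p)]. *)
pose m (p : nat * R * R) := up_log 2 (2 * maxn 1 (D p)).
pose r (p : nat * R * R) := (Num.truncn (ln p.1.1%:R / ln p.2)).+1.
have ln2 : 0 < ln 2 :> R by rewrite ln_gt0 ?ltr1n.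
(* The first two factors come from the bound on [L p], the last from [2 ^ m p], with one [kappa] for
   each direction of the arboricity estimate. *)
pose Ccol : R := c.+1%:R * (2 / ln 2) * (8 * kappa ^+ 2).
have kappa0 : 0 < kappa := lt_le_trans ltr01 kappa1.
have Ccol0 : 0 <= Ccol.
  by rewrite /Ccol !mulr_ge0 ?exprn_ge0 ?invr_ge0 ?ler0n ?(ltW ln2) ?(ltW kappa0).
exists (peel_algorithm D L m r), (1 + Ccol).
move=> n a t V e id cardV n2 syme irre _ _ arb_le le_arb t2 _ p.
have t1 : 1 < t by apply: lt_trans t2; rewrite ltr1n.
have t0 : 0 < t := lt_trans ltr01 t1.
have lnn0 : 0 < ln n%:R :> R by rewrite ln_gt0 // ltr1n.
have ratio0 : 0 <= ln n%:R / ln t by rewrite divr_ge0 ?(ltW lnn0) ?(ltW (ln_gt0 t1)).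
have ka0 : 0 <= kappa * a := le_trans (ler0n _ _) arb_le.
split.
  have le_rounds : (r p)%:R <= ln n%:R / ln t + (logstar n)%:R.
    (* The [logstar] term, at least 1, absorbs the extra round. *)
    rewrite -natr1 lerD ?truncn_le // ler1n; exact: logstar_gt0.
  apply: le_trans le_rounds _; rewrite mulrDl mul1r lerDl mulr_ge0 // addr_ge0 //.
exists (L p * 2 ^ m p)%N; split.
  set arb := (maxn 1 _)%:R.
  have arb1 : 1 <= arb by rewrite ler1n leq_maxl.
  have leD : (maxn 1 (D p))%:R <= 2 * kappa ^+ 2 * (t * arb).
    have le1 : 1 <= 2 * kappa ^+ 2 * (t * arb).
      by rewrite !mulr_ege1 ?arb1 ?exprn_ege1 ?(ltW t1) ?ler1n.
    rewrite /maxn; case: ifP => // _.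
    apply: le_trans (_ : 2 * t * (kappa * a) <= _).
      by rewrite /D truncn_le mulr_ge0 // mulr_ge0 ?(ltW t0).
    have -> : 2 * kappa ^+ 2 * (t * arb) = 2 * t * (kappa * (kappa * arb)) by ring.
    rewrite ler_pM2l ?mulr_gt0 // ler_pM2l //; apply: le_trans le_arb _.
    by rewrite ler_pM2l // ler_nat leq_maxr.
  have lem : (2 ^ m p)%:R <= 8 * kappa ^+ 2 * (t * arb).
    have gt1 : (1 < 2 * maxn 1 (D p))%N by lia.
    have /andP[lt_m _] := up_log_bounds (isT : (1 < 2)%N) gt1.
    have : (2 ^ m p <= 4 * maxn 1 (D p))%N.
      have m0 : (0 < m p)%N by rewrite up_log_gt0.
      by rewrite -(prednK m0) expnS -[4%N]/(2 * 2)%N -mulnA leq_mul2l ltnW.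
    rewrite -(ler_nat R) natrM => /le_trans; apply.
    have -> : 8 * kappa ^+ 2 * (t * arb) = 4 * (2 * kappa ^+ 2 * (t * arb)) by ring.
    by rewrite ler_pM2l ?ltr0n.
  have leL : (L p)%:R <= c.+1%:R * (2 / ln 2 * ln n%:R) :> R.
    by rewrite /L natrM ler_pM2l ?ltr0n // up_log2_le_ln.
  rewrite [leLHS]natrM; apply: le_trans (ler_pM _ _ leL lem) _ => //.
  have -> : c.+1%:R * (2 / ln 2 * ln n%:R) * (8 * kappa ^+ 2 * (t * arb)) =
    Ccol * (t * arb * ln n%:R) by rewrite /Ccol; ring.
  by rewrite ler_wpM2r ?lerDr // !mulr_ge0 ?(ltW t0) ?(ltW lnn0) ?(le_trans ler01 arb1).
have alive0 : alive e (D p) (r p) = set0.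
  (* It suffices that fewer than one vertex is left, which holds because [t ^+ r p] exceeds [n]. *)
  apply/eqP; rewrite -cards_eq0 -leqn0 -ltnS -(ltr_nat R).
  have tr0 : 0 < t ^+ r p by rewrite exprn_gt0.
  rewrite -(ltr_pM2r tr0) mul1r.
  apply: le_lt_trans (ltr_expr_trunc_ln n2 t1); rewrite -cardV.
  apply: card_alive => //; first exact: ltW.
  apply: le_trans (ltW (truncnS_gt _)).
  by rewrite /= ler_pM2l ?mulr_gt0.
have V_gt0 : (0 < #|V|)%N by rewrite cardV ltnW.
have leDm : (2 * D p <= 2 ^ m p)%N.
  by apply: leq_trans (up_logP _ (isT : (1 < 2)%N)); rewrite leq_mul2l leq_maxr orbT.
have leVL : (#|V| ^ c.+1 <= 2 ^ L p)%N.
  rewrite cardV /L mulnC expnM; apply: leq_exp2; exact: up_logP.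
have := card_improper id syme irre alive0 V_gt0 leDm leVL.
rewrite /uniform_prob cardV.
set A := peel_algorithm D L m r; set q := (L p * 2 ^ m p)%N.
set bad := [set w | _]; set good := [pred w | _].
have cardT : (#|good| + #|bad| = #|coin_tosses A p V|)%N.
  by rewrite -(cardC good) cardsE; congr addn; apply: eq_card => w; rewrite !inE.
have T0 : 0 < #|coin_tosses A p V|%:R :> R.
  by rewrite ltr0n card_coin_tosses !expn_gt0.
have nc0 : 0 < n%:R ^+ c :> R by rewrite exprn_gt0 // ltr0n ltnW.
rewrite -(ler_nat R) natrM natrX -ler_pdivlMr // => le_bad.
rewrite ler_pdivlMr // mulrBl mul1r lerBlDr -[X in X%:R <= _]cardT natrD lerD2l.
by rewrite mulrC.
Qed.
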